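(* Let $\sigma_1=\sum_{n\ge 0}S_n$ and let $\varphi_m$ denote the homogeneous component of degree $m$ of $\log\sigma_1$. The coefficient of $\alpha^k$ in $\sigma_1^\alpha=\exp(\alpha\log\sigma_1)$ is $$\frac1{k!}\sum_{\ell(I)=k}\varphi^I,\qquad \varphi^I=\varphi_{i_1}\cdots\varphi_{i_k}\ \text{ for } I=(i_1,\dots,i_k).$$ Hence, for every plane forest $F$ with $n$ vertices, the coefficient of $X_F$ in the Eulerian idempotent $$e_n^{(k)}=\frac1{k!}\sum_{I\vDash n,\ \ell(I)=k}\varphi^I,$$ viewed as an element of $\mathcal{H}_{NCK}^*$, is $$[\alpha^k]\,\Gamma_F(\alpha)=(-1)^{|F|}[\alpha^k]\,\chi_F(\alpha).$$
   Context: **Plane forests.** Vertices of a plane forest $F$ with $n=|F|$ vertices are labelled $1,\dots,n$ in postorder; $i<_Fj$ means that $i$ is a proper descendant of $j$. $L(F)$ is the set of linear extensions of $F$: permutations $\sigma\in\mathfrak{S}_n$ such that $i<_Fj\Rightarrow\sigma^{-1}(i)<\sigma^{-1}(j)$. **$\mathcal{H}_{NCK}$ and its dual.** The noncommutative Connes-Kreimer algebra $\mathcal{H}_{NCK}$ has basis $Y_F$ ($F$ plane forests), product = concatenation, coproduct $\Delta Y_F=\sum_u Y_{F_{(1)}}\otimes Y_{F_{(2)}}$, the sum over words $u\in\{1,2\}^{|F|}$ with $i<_Fj\Rightarrow u_i\le u_j$, where $F_{(k)}$ is the restriction of $F$ to the vertices $i$ with $u_i=k$. $X_F$ is the dual basis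 of the graded dual $\mathcal{H}_{NCK}^*$, whose product is dual to $\Delta$; infinite sums are taken in the completion. **$\mathbf{Sym}$.** The algebra of noncommutative symmetric functions $\mathbf{Sym}=\mathbb{C}\langle S_1,S_2,\dots\rangle$, $S_0=1$, is embedded in $\mathcal{H}_{NCK}^*$ by $S_n=\sum_{|F|=n}X_F$. The $\Lambda_n$ are defined by $\sum_{n\ge0}(-1)^n\Lambda_n=\left(\sum_{n\ge0}S_n\right)^{-1}$ (equivalently, $\Lambda_n=X_{\bullet\bullet\cdots\bullet}$ with $n$ vertices), and $\lambda_1=\sum_{n\ge0}\Lambda_n$. **The polynomials.** $\Gamma_F(\alpha)=\sum_{\sigma\in L(F)}\binom{\alpha+n-r(\sigma)}{n}$, where $r(\sigma)-1$ is the number of descents of $\sigma$ (positions $p$ with $\sigma(p)>\sigma(p+1)$). $\chi_F(\alpha)$ is the coefficient of $X_F$ in $\lambda_1^\alpha=\exp(\alpha\log\lambda_1)$, that is, $\chi_F(\alpha)=(-1)^{|F|}\Gamma_F(-\alpha)$. $[\alpha^k]$ denotes the coefficient of $\alpha^k$; $I\vDash n$ means that $I$ is a composition of $n$, and $\ell(I)$ is its number of parts.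
   Formalization: The last formula is proved as [α^k]Γ_F(α) = (−1)^{|F|}[α^k]χ_F(−α), with −α in place of α as the argument of χ_F, since the printed form fails for a single vertex and k = 1 (where Γ_F = χ_F = α). *)

(* Defs.v *)
(* MathComp; R[i] over a realType R plays the role of the complex numbers. *)
From mathcomp Require Export all_boot all_order all_fingroup all_algebra.
From mathcomp Require Export reals complex.

Set Implicit Arguments.
Unset Strict Implicit.
Unset Printing Implicit Defensive.

Import GRing.Theory.
Local Open Scope ring_scope.

(** * Completed graded dual of a graded coalgebra with basis

    [elt] indexes a homogeneous basis (Y_t) of a connected graded coalgebra
    with Delta Y_t = \sum_((a, b) <- cop t) Y_a (x) Y_b. *)
Record gbasis := GBasis {
  elt :> Type;
  deg : elt -> nat;
  cop : elt -> seq (elt * elt);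
  cop_deg : forall t, all (fun p => deg p.1 + deg p.2 == deg t)%N (cop t) }.

(* The completion of the graded dual, with coefficients in A: x stands for the
   infinite sum \sum_t (x t) X_t, where (X_t) is the basis dual to (Y_t). *)
Definition series (B : gbasis) (A : Type) := B -> A.

Section Series.
Variables (B : gbasis) (A : nzRingType).
Implicit Types x y : series B A.

Definition sone : series B A := fun t => (deg t == 0%N)%:R.

Definition ssub x y : series B A := fun t => x t - y t.

(* The product dual to the coproduct. *)
Definition smul x y : series B A :=
  fun t => \sum_(p <- cop t) x p.1 * y p.2.

Definition sprod (xs : seq (series B A)) : series B A := foldr smul sone xs.

Definition spow x (k : nat) : series B A := iter k (smul x) sone.

Definition homog (m : nat) x : series B A :=
  fun t => if deg t == m then x t else 0.

(* Sum of a sequence of series whose n-th term has no component of degree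
   smaller than n; see [ssum_stable] and [spow_vanish]. *)
Definition ssum (x : nat -> series B A) : series B A :=
  fun t => \sum_(n < (deg t).+1) x n t.

Lemma ssum_stable (x : nat -> series B A) t :
  (forall n, (deg t < n)%N -> x n t = 0) ->
  forall N, (deg t < N)%N -> \sum_(n < N) x n t = ssum x t.
Proof.
move=> x0 N ltN; rewrite /ssum.
rewrite -(big_mkord xpredT (fun n => x n t)).
rewrite (big_cat_nat _ ltN) //= big_mkord [X in _ + X](_ : _ = 0) ?addr0 //.
by rewrite big_nat big1 // => n /andP[lt _]; apply: x0.
Qed.

Lemma spow_vanish x : (forall t, deg t = 0%N -> x t = 0) ->
  forall k t, (deg t < k)%N -> spow x k t = 0.
Proof.
move=> x0; elim=> [//|k IH] t ltk; rewrite /= /smul.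
elim: (cop t) (cop_deg t) => [_|p s IHs /= /andP[/eqP dp /IHs sE]].
  by rewrite big_nil.
rewrite big_cons sE addr0.
have [/x0 -> | d0] := eqVneq (deg p.1) 0%N; first by rewrite mul0r.
rewrite -/(spow x k) IH ?mulr0 // -ltnS (leq_trans _ ltk) // ltnS -dp.
by rewrite -[X in (X < _)%N]add0n ltn_add2r lt0n.
Qed.

End Series.

Arguments sone {B A}.

Section PowerSeries.
Variables (B : gbasis) (K : fieldType).

(* The three functions below are meant for x with constant term 1 (for [sinv]
   and [slog]) or 0 (for [sexp]). *)
Definition sinv (x : series B K) : series B K :=
  ssum (fun k => spow (ssub sone x) k).

(* The term k = 0 is zero, since 0^-1 = 0. *)
Definition slog (x : series B K) : series B K :=
  ssum (fun k t => (-1) ^+ k.+1 / k%:R * spow (ssub x sone) k t).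

Definition sexp (x : series B {poly K}) : series B {poly K} :=
  ssum (fun k t => (k`!%:R^-1 : K) *: spow x k t).

(* x^alpha = exp (alpha log x), where alpha is the polynomial variable 'X. *)
Definition spowX (x : series B K) : series B {poly K} :=
  sexp (fun t => slog x t *: 'X).

End PowerSeries.

(** * Compositions and Sym *)

Definition posnat := {m : nat | (0 < m)%N}.
Definition composition := seq posnat.
Definition comp_deg (I : composition) : nat := sumn [seq val i | i <- I].

(* All the compositions of n: those of n.+1 are obtained from those of n by
   prepending a part 1 or by increasing the first part. *)
Fixpoint comps (n : nat) : seq composition :=
  if n is n'.+1 then
    flatten [seq ((exist _ 1%N isT : posnat) :: w)
      :: (if w is i :: v then [:: (exist _ (val i).+1 isT : posnat) :: v]
          else [::]) | w <- comps n']
  else [:: [::]].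

Lemma mem_comps n (I : composition) : (I \in comps n) = (comp_deg I == n).
Proof.
elim: n I => [|n IH] I.
  rewrite /= inE; case: I => [//|[[//|m] pm] J]; by rewrite /comp_deg /= addSn.
apply/flatten_mapP/idP => [[J]|].
  rewrite IH => /eqP dJ; rewrite inE => /orP[/eqP ->|].
    by rewrite /comp_deg /= -[sumn _]/(comp_deg J) dJ.
  case: J dJ => [//|i J] dJ; rewrite inE => /eqP ->.
  by rewrite -dJ /comp_deg /= addSn.
case: I => [//|[[//|[|m]] pm] J]; rewrite /comp_deg /= addSn eqSS => dI.
  exists J; first by rewrite IH.
  by rewrite inE; apply/orP; left; apply/eqP; congr cons; apply: val_inj.
exists ((exist _ m.+1 isT : posnat) :: J).
  by rewrite IH /comp_deg.
rewrite !inE; apply/orP; right; apply/eqP; congr cons; exact: val_inj.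
Qed.

Lemma comps_uniq n : uniq (comps n).
Proof.
elim: n => [//|n IH] /=.
have {IH} := IH; elim: (comps n) => [//|I s IHs] /= /andP[Is us].
have hd (a b : posnat) (J J' : composition) :
    a :: J = b :: J' -> val a = val b /\ J = J'.
  by case=> -> ->.
rewrite cat_uniq IHs // andbT; apply/and3P; split.
- rewrite mem_cat negb_or; apply/andP; split.
    by case: I {Is} => [|[[//|i] pi] J] //; rewrite inE; apply/eqP; case/hd.
  apply/flatten_mapP => -[J Js]; rewrite inE => /orP[/eqP /hd[_ E]|].
    by rewrite E Js in Is.
  case: J Js => [//|[[//|i] pi] J] _; rewrite inE => /eqP.
  by case/hd.
- by case: (I).
apply/hasPn => J' /flatten_mapP[J Js]; case: I Is => [//|i I] Is.
rewrite inE => /orP[/eqP ->|]; last case: J Js => [//|j J] Js.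
  by rewrite inE; case: i Is => [[//|i] pi] Is; apply/eqP; case/hd.
rewrite inE => /eqP ->; rewrite inE; apply/eqP; case/hd=> [[E] EJ].
by move: Is; rewrite -EJ -(val_inj E) Js.
Qed.

(* Deconcatenation, which is dual to the concatenation of words. *)
Definition comp_cop (I : composition) : seq (composition * composition) :=
  [seq (take i I, drop i I) | i <- iota 0 (size I).+1].

Lemma comp_cop_deg I :
  all (fun p => comp_deg p.1 + comp_deg p.2 == comp_deg I)%N (comp_cop I).
Proof.
apply/allP => _ /mapP[i _ ->] /=.
by rewrite /comp_deg -sumn_cat -map_cat cat_take_drop.
Qed.

(* The dual of this coalgebra is the free algebra on S_1, S_2, ... : the basis
   element dual to Y_I is the word S^I. *)
Definition Sym_basis : gbasis := GBasis comp_cop_deg.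

(** * Plane forests *)

(* [Graft c r] is the plane forest whose first tree is a root with forest of
   subtrees c, and whose remaining trees form the plane forest r. *)
Inductive forest := Empty | Graft of forest & forest.

Fixpoint fsize (F : forest) : nat :=
  if F is Graft c r then (fsize c + fsize r).+1 else 0%N.

Fixpoint fcat (F G : forest) : forest :=
  if F is Graft c r then Graft c (fcat r G) else G.

(* Vertices are numbered 0, ..., fsize F - 1 in postorder: in [Graft c r], those
   of c come first, then the root, which has number fsize c, then those of r. *)

(* [fdesc F i j]: vertex i is a proper descendant of vertex j. *)
Fixpoint fdesc (F : forest) (i j : nat) : bool :=
  if F is Graft c r then
    let m := fsize c in
    if (j < m)%N then fdesc c i j
    else if j == m then (i < m)%N
    else (m < i)%N && fdesc r (i - m.+1) (j - m.+1)
  else false.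

(* Restriction of F to the vertices satisfying P; the children of a deleted
   vertex are put in its place. *)
Fixpoint frestr (F : forest) (P : pred nat) : forest :=
  if F is Graft c r then
    let m := fsize c in
    let c' := frestr c P in
    let r' := frestr r (fun i => P (m.+1 + i)%N) in
    if P m then Graft c' r' else fcat c' r'
  else Empty.

(* The words u in {1,2}^|F| (1 is encoded by false and 2 by true) such that
   u_i <= u_j whenever i is a proper descendant of j. *)
Definition admissible (F : forest) (u : (fsize F).-tuple bool) : bool :=
  [forall i : 'I_(fsize F), forall j : 'I_(fsize F),
     fdesc F i j ==> (tnth u i <= tnth u j)%N].

Definition forest_cop (F : forest) : seq (forest * forest) :=
  [seq (frestr F (fun i => ~~ nth false u i), frestr F (fun i => nth false u i))
     | u : (fsize F).-tuple bool in admissible (F := F)].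

Lemma fsize_cat F G : fsize (fcat F G) = (fsize F + fsize G)%N.
Proof. by elim: F => //= c _ r ->; rewrite addSn addnA. Qed.

Lemma fsize_restr F (P : pred nat) :
  (fsize (frestr F (fun i => ~~ P i)) + fsize (frestr F P))%N = fsize F.
Proof.
elim: F P => //= c IHc r IHr P.
rewrite -[in RHS](IHc P) -[in RHS](IHr (fun i => P ((fsize c).+1 + i)%N)).
by case: (P _) => /=; rewrite fsize_cat ?addSn ?addnS addnACA.
Qed.

Lemma forest_cop_deg F :
  all (fun p => fsize p.1 + fsize p.2 == fsize F)%N (forest_cop F).
Proof. by rewrite all_map; apply/allP => u _; rewrite /= fsize_restr. Qed.

(* A series over [NCK_basis] is an element of the completion of H_NCK^*, and
   its value at F is the coefficient of X_F. *)
Definition NCK_basis : gbasis := GBasis forest_cop_deg.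

(** * Noncommutative symmetric functions *)

(* The generator S_n as an element of Sym, with S_0 = 1. *)
Definition S_Sym (K : fieldType) (n : nat) : series Sym_basis K :=
  fun I => ([seq val i | i <- I] == if n is 0 then [::] else [:: n])%:R.

(* S_n = \sum_(|F| = n) X_F. *)
Definition S_NCK (A : nzRingType) (n : nat) : series NCK_basis A :=
  fun F => (fsize F == n)%:R.

(* The embedding of (the completion of) Sym: it maps \sum_I f_I S^I to
   \sum_I f_I S_(i_1) ... S_(i_r), computed in the completion of H_NCK^*; only
   the compositions of |F| contribute to the coefficient of X_F. *)
Definition embed (A : nzRingType) (f : series Sym_basis A) :
    series NCK_basis A :=
  fun F => \sum_(I <- comps (fsize F))
             f I * sprod [seq S_NCK A (val i) | i <- I] F.

Section Sym.
Variable K : fieldType.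

Definition sigma1 : series Sym_basis K := ssum (S_Sym K).

(* \sum_n (-1)^n Lambda_n = sigma1^-1. *)
Definition Lambda (n : nat) : series Sym_basis K :=
  fun I => (-1) ^+ n * homog n (sinv sigma1) I.

Definition lambda1 : series Sym_basis K := ssum Lambda.

Definition phi (m : nat) : series Sym_basis K := homog m (slog sigma1).

Definition phi_prod (I : composition) : series Sym_basis K :=
  sprod [seq phi (val i) | i <- I].

Definition eulerian (n k : nat) : series Sym_basis K :=
  fun J => k`!%:R^-1 * \sum_(I <- comps n | size I == k) phi_prod I J.

(* chi_F(alpha): the coefficient of X_F in lambda1^alpha. *)
Definition chi (F : forest) : {poly K} := embed (spowX lambda1) F.

End Sym.

(** * Linear extensions *)

Definition linext (F : forest) : {set 'S_(fsize F)} :=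
  [set s : 'S_(fsize F) | [forall i : 'I_(fsize F), forall j : 'I_(fsize F),
     fdesc F i j ==> ((s^-1)%g i < (s^-1)%g j)%N]].

Definition descents (n : nat) (s : 'S_n) : {set 'I_n} :=
  [set p : 'I_n | [exists q : 'I_n, (q == p.+1 :> nat) && (s q < s p)%N]].

Definition binpoly (K : fieldType) (p : {poly K}) (n : nat) : {poly K} :=
  (n`!%:R^-1 : K) *: \prod_(j < n) (p - j%:R).

(* r(s) = #|descents s| + 1. *)
Definition Gamma (K : fieldType) (F : forest) : {poly K} :=
  \sum_(s in linext F)
     binpoly ('X + (fsize F)%:R - #|descents s|.+1%:R) (fsize F).

(* Main.v *)
Require Import Defs.
From mathcomp Require Import zify ring.

Set Implicit Arguments.
Unset Strict Implicit.
Unset Printing Implicit Defensive.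

Import Order.TTheory GRing.Theory Num.Theory.
Local Open Scope ring_scope.

(** The first assertion is formal: the coefficient of alpha^k in exp (alpha log
sigma_1) is (log sigma_1)^k / k!, and since log sigma_1 has no constant term,
expanding its k-th power into homogeneous components gives the sum of the phi^I
over the compositions I with k parts ([spow_homog]). In particular e_n^(k) is
the component of degree n of the coefficient of alpha^k in sigma_1^alpha.

For the second one, everything is reduced to counting. In Sym, the coefficient
of S^J in sigma_1 only depends on the length of J (it is 1 when J has at most
one part), and series of this kind multiply like power series in one variable
x, sigma_1 corresponding to 1 + x. Hence sigma_1^alpha corresponds to
(1 + x)^alpha, and the coefficient of S^J in sigma_1^alpha is the polynomial
binom(alpha, l(J)) ([spowX_sigma1]). Likewise sigma_1^-1 corresponds to
1 / (1 + x), and lambda_1 is obtained from it by the automorphism that multiplies the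
component of degree n by (-1)^n; so the coefficient of S^J in lambda_1^alpha is
(-1)^n binom(-alpha, l(J)) for J a composition of n ([spowX_lambda1]). This
gives Gamma_F(alpha) = (-1)^n chi_F(-alpha) once it is known that
Gamma_F(alpha) is the coefficient of X_F in sigma_1^alpha.

It is enough to compare these two polynomials at every positive integer m, and
both values are the number of order-preserving maps from F to a chain of m
elements. On the one hand, sigma_1 is embedded as the sum of all the X_F, and
binom(m, l(J)) is also the coefficient of S^J in the expansion of
(1 + sum_(n > 0) S_n)^m ([pow_ones_comps]); the m-th power of the sum of all the X_F counts
order-preserving maps because both sides obey the same recursion on the first
tree of F ([pow_ones_count]). On the other hand, by Stanley's theory of
P-partitions, postorder being a natural labelling of F, each order-preserving
map is sorted by exactly one permutation, which is a linear extension, and a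
linear extension s sorts binom(m + n - r(s), n) maps ([Gamma_nat]). *)

(** * Generalities on graded series *)

Lemma eq_smul (B : gbasis) (A : nzRingType) (x x' y y' : series B A) :
  x =1 x' -> y =1 y' -> smul x y =1 smul x' y'.
Proof. by move=> xE yE t; apply: eq_bigr => p _; rewrite xE yE. Qed.

Lemma eq_spow (B : gbasis) (A : nzRingType) (x y : series B A) k :
  x =1 y -> spow x k =1 spow y k.
Proof. by move=> xE; elim: k => [//|k IH] /=; apply: eq_smul. Qed.

Lemma big_cop_deg (A : nmodType) (B : gbasis) (t : B) (h h' : B * B -> A) :
  (forall p, (deg p.1 + deg p.2)%N = deg t -> h p = h' p) ->
  \sum_(p <- cop t) h p = \sum_(p <- cop t) h' p.
Proof.
move=> hE; elim: (cop t) (cop_deg t) => [_|p s IH /= /andP[/eqP dp /IH sE]].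
  by rewrite !big_nil.
by rewrite !big_cons sE hE.
Qed.

Lemma sum_ord_vanish (A : nmodType) n N (f : nat -> A) :
  (forall k, (n < k)%N -> f k = 0) -> (n < N)%N ->
  \sum_(k < N) f k = \sum_(k < n.+1) f k.
Proof.
move=> f0 lt_nN; rewrite (big_ord_widen N f lt_nN) [RHS]big_mkcond.
by apply: eq_bigr => k _; rewrite ltnS; case: leqP => // /f0.
Qed.

Definition part (i : nat) : posnat := exist _ i.+1 isT.

(** Compositions of [n.+1] sorted by their first part, whereas [comps] builds
them by comparing the first part with 1. *)
Lemma big_comps (A : nmodType) n (h : composition -> A) :
  \sum_(I <- comps n.+1) h I =
    \sum_(i < n.+1) \sum_(J <- comps (n - i)) h (part i :: J).
Proof.
have step m (g : composition -> A) : \sum_(I <- comps m.+1) g I =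
    \sum_(w <- comps m) g (part 0 :: w) +
    \sum_(w <- comps m) (if w is i :: v then g (part (val i) :: v) else 0).
  rewrite /= big_flatten big_map -big_split /=; apply: eq_bigr => -[|i v] _.
    by rewrite big_cons big_nil.
  by rewrite !big_cons big_nil addr0.
elim: n h => [|n IH] h.
  by rewrite step big_ord1 /= !big_cons !big_nil !addr0.
by rewrite step [RHS]big_ord_recl; congr (_ + _); rewrite IH.
Qed.

(** Splitting each factor of the k-th power into homogeneous components gives
one product per k-tuple of degrees; degree 0 contributes nothing, and the
degrees must add up to the degree of [t]. *)
Lemma spow_homog (B : gbasis) (A : nzRingType) (x : series B A) k (t : B) :
  (forall u, deg u = 0%N -> x u = 0) ->
  spow x k t = \sum_(I <- comps (deg t) | size I == k)
                 sprod [seq homog (val i) x | i <- I] t.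
Proof.
move=> x0; elim: k t => [|k IH] t.
  rewrite /= /sone; case dt: (deg t) => [|n].
    by rewrite /= big_cons big_nil /= addr0 /sone dt.
  rewrite big_mkcond big_comps big1 // => i _.
  by rewrite big1.
rewrite /= /smul.
rewrite (eq_bigr (fun p => \sum_(I <- comps (deg p.2) | size I == k)
    x p.1 * sprod [seq homog (val i) x | i <- I] p.2)); last first.
  by move=> p _; rewrite -/(spow x k) IH mulr_sumr.
case dt: (deg t) => [|n].
  rewrite /= big_cons big_nil /=.
  rewrite (big_cop_deg (h' := fun => 0)) ?big1_eq // => p dp.
  apply: big1 => I _; rewrite x0 ?mul0r //; lia.
rewrite [RHS]big_mkcond [RHS]big_comps.
have -> : \sum_(i < n.+1) \sum_(J <- comps (n - i))
     (if size (part i :: J) == k.+1 then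
       sprod [seq homog (val i0) x | i0 <- part i :: J] t else 0)
   = \sum_(i < n.+1) \sum_(p <- cop t) \sum_(J <- comps (n - i) | size J == k)
       homog i.+1 x p.1 * sprod [seq homog (val j) x | j <- J] p.2.
  apply: eq_bigr => i _; rewrite exchange_big [RHS]big_mkcond.
  by apply: eq_bigr => J _.
rewrite exchange_big; apply: big_cop_deg => p; rewrite dt => dp /=.
case d1: (deg p.1) => [|d].
  rewrite big1 => [|I _]; last by rewrite x0 ?mul0r.
  rewrite big1 // => i _; rewrite big1 // => J _.
  by rewrite /homog d1 mul0r.
have ltd : (d < n.+1)%N by lia.
rewrite (bigD1 (Ordinal ltd)) //= [X in _ + X]big1 ?addr0 => [|i].
  have -> : (n - d = deg p.2)%N by lia.
  by apply: eq_bigr => J _; rewrite /homog d1 eqxx.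
rewrite -val_eqE /= => /eqP ne; apply: big1 => J _.
rewrite /homog d1; case: eqP => [[e]|]; last by rewrite mul0r.
by case: ne.
Qed.

Lemma sprod_homog_eq0 (B : gbasis) (A : nzRingType) (x : series B A)
    (I : composition) (t : B) :
  deg t != comp_deg I -> sprod [seq homog (val i) x | i <- I] t = 0.
Proof.
elim: I t => [|i I IH] t /=; first by rewrite /sone /comp_deg /= => /negPf->.
move=> ne; rewrite /smul (big_cop_deg (h' := fun => 0)) ?big1_eq // => p dp.
rewrite /homog; case: eqP => [d1|]; last by rewrite mul0r.
rewrite IH ?mulr0 //; apply: contra ne => /eqP d2.
by rewrite -dp d1 d2.
Qed.

Lemma sprod_morph (B : gbasis) (A A' : nzRingType) (f : {rmorphism A -> A'})
    (xs : seq (series B A)) t :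
  sprod [seq (fun u => f (x u)) | x <- xs] t = f (sprod xs t).
Proof.
elim: xs t => [|x xs IH] t /=; first by rewrite /sone rmorph_nat.
by rewrite /smul rmorph_sum; apply: eq_bigr => p _; rewrite rmorphM IH.
Qed.

(** Multiplying the component of degree n by (-1)^n is an algebra automorphism,
because the coproduct is graded. *)
Lemma smul_sign (B : gbasis) (A : comNzRingType) (x y : series B A) t :
  smul (fun u => (-1) ^+ deg u * x u) (fun u => (-1) ^+ deg u * y u) t
  = (-1) ^+ deg t * smul x y t.
Proof.
rewrite /smul mulr_sumr; apply: big_cop_deg => p <-.
by rewrite exprD; ring.
Qed.

Lemma spow_sign (B : gbasis) (A : comNzRingType) (x : series B A) k t :
  spow (fun u => (-1) ^+ deg u * x u) k t = (-1) ^+ deg t * spow x k t.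
Proof.
elim: k t => [|k IH] t /=.
  by rewrite /sone; case: (deg t) => [|n]; rewrite ?mulr0 // mulr1.
by rewrite -smul_sign; apply: eq_smul => // u; apply: IH.
Qed.

(** * Series on Sym that depend on lengths only *)

Lemma comp_deg_eq0 (I : composition) : (comp_deg I == 0%N) = (size I == 0%N).
Proof. by case: I => [//|[[//|i] pi] I]. Qed.

Lemma size_le_deg (I : composition) : (size I <= comp_deg I)%N.
Proof.
elim: I => [//|[[//|i] pi] I IH]; rewrite /comp_deg /= addSn ltnS.
by rewrite (leq_trans IH) // leq_addl.
Qed.

(** A series on Sym whose coefficients only depend on the length of the
composition is a power series in one variable, since cutting a word of length n
in two amounts to writing n as a sum. Power series are represented by
polynomials, known up to degree [N] only. *)
Lemma spow_size (A : nzRingType) (x : series Sym_basis A) (P : {poly A}) N :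
  (forall J : composition, (size J <= N)%N -> x J = P`_(size J)) ->
  forall k (J : composition), (size J <= N)%N ->
  spow x k J = (P ^+ k)`_(size J).
Proof.
move=> xP; elim=> [|k IH] J leJ /=.
  by rewrite expr0 /sone coef1 /= comp_deg_eq0.
rewrite /smul /= /comp_cop big_map exprS coefM.
rewrite -[iota _ _]/(index_iota 0 (size J).+1) big_mkord; apply: eq_bigr => i _.
have lei : (i <= size J)%N by rewrite -ltnS.
rewrite xP ?IH ?size_drop ?size_takel // (leq_trans _ leJ) ?leq_subr //.
Qed.

Lemma coef0_factorX (A : nzRingType) (Z : {poly A}) :
  Z`_0 = 0 -> exists W, Z = W * 'X.
Proof.
move=> Z0; exists (\poly_(i < (size Z).-1) Z`_i.+1).
apply/polyP=> -[|i]; rewrite coefMX //= coef_poly; case: ltnP => // le.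
by rewrite nth_default //; lia.
Qed.

Lemma coef_exp_lt (A : comNzRingType) (Z : {poly A}) n k :
  Z`_0 = 0 -> (n < k)%N -> (Z ^+ k)`_n = 0.
Proof.
by case/coef0_factorX=> W -> lt_nk; rewrite exprMn coefMXn lt_nk.
Qed.

Lemma horner_binpoly (K : fieldType) (p : {poly K}) n x :
  (binpoly p n).[x] = (binpoly 'X n).[p.[x]].
Proof.
rewrite /binpoly !hornerZ !horner_prod; congr (_ * _).
by apply: eq_bigr => j _; rewrite -polyC_natr !hornerE.
Qed.

Lemma comp_binpoly (K : fieldType) (p q : {poly K}) n :
  binpoly p n \Po q = binpoly (p \Po q) n.
Proof.
rewrite /binpoly comp_polyZ rmorph_prod; congr (_ *: _).
apply: eq_bigr => j _; rewrite rmorphB /=.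
by rewrite -polyC_natr comp_polyC polyC_natr.
Qed.

Lemma binpoly_nat (K : numFieldType) n m :
  (binpoly 'X n).[m%:R] = 'C(m, n)%:R :> K.
Proof.
rewrite /binpoly hornerZ horner_prod.
have -> : \prod_(j < n) ('X - j%:R : {poly K}).[m%:R] = (m ^_ n)%:R.
  elim: n => [|n IH]; first by rewrite big_ord0.
  rewrite big_ord_recr /= IH ffactnSr natrM hornerD hornerX hornerN.
  rewrite -polyC_natr hornerC; case: (leqP n m) => le; first by rewrite natrB.
  by rewrite ffact_small // !mul0r.
rewrite -bin_ffact natrM mulrC mulfK // pnatr_eq0 -lt0n; exact: fact_gt0.
Qed.

Lemma binpolyS (K : numFieldType) (p : {poly K}) n :
  n.+1%:R *: binpoly p n.+1 = (p - n%:R) * binpoly p n.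
Proof.
rewrite /binpoly scalerA big_ord_recr /= -scalerAr [in RHS]mulrC.
by rewrite factS natrM invfM mulrA divff ?pnatr_eq0 // mul1r.
Qed.

Section Exp.
Variables (K : numFieldType) (L : {poly K}) (c : K) (N : nat).
Hypothesis L0 : L`_0 = 0.
Hypothesis dL : forall n, (n < N)%N -> ((1 + 'X) * L^`())`_n = (c%:P)`_n.

(* The coefficient of x^n in exp (X L), where the exponential series is truncated
   after its term of degree [D]: for n <= D the other terms do not contribute. *)
Let expc n D : {poly K} := \sum_(k < D.+1) (k`!%:R^-1 * (L ^+ k)`_n) *: 'X^k.

(* The coefficient of x^n in (1 + x) (L^(k+1))' = (k+1) c L^k. *)
Let coef_pow_rec n k : (n < N)%N ->
  n.+1%:R * (L ^+ k.+1)`_n.+1 + n%:R * (L ^+ k.+1)`_n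
    = k.+1%:R * c * (L ^+ k)`_n.
Proof.
move=> lt_nN.
have dE j : j%:R * (L ^+ k.+1)`_j = ('X * (L ^+ k.+1)^`())`_j.
  rewrite coefXM; case: j => [|j] /=; first by rewrite mul0r.
  by rewrite coef_deriv mulr_natl.
have -> : n.+1%:R * (L ^+ k.+1)`_n.+1 + n%:R * (L ^+ k.+1)`_n
     = ((1 + 'X) * (L ^+ k.+1)^`())`_n.
  by rewrite dE coefXM /= mulrDl mul1r coefD dE.
have -> : (1 + 'X) * (L ^+ k.+1)^`() = k.+1%:R *: (L ^+ k * ((1 + 'X) * L^`())).
  by rewrite deriv_exp /= scaler_nat -mulrnAl mulrCA -mulr_natr; ring.
rewrite coefZ -mulrA; congr (_ * _); rewrite mulrC.
rewrite [c * _](_ : _ = (c%:P * L ^+ k)`_n); last by rewrite coefCM.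
rewrite !coefM; apply: eq_bigr => i _; rewrite dL //.
by rewrite (leq_ltn_trans _ lt_nN) // -ltnS.
Qed.

(** If (1 + x) L' = c, then f = exp (X L) satisfies the differential equation
(1 + x) f' = c X f, whose coefficients obey the recursion that defines the
binomials of c X. *)
Lemma exp_binpoly n D : (n <= N)%N -> (n <= D)%N ->
  expc n D = binpoly (c *: 'X) n.
Proof.
elim: n D => [|n IH] D leN leD.
  rewrite /expc big_ord_recl big1 /= => [|i _].
    by rewrite /binpoly big_ord0 coef1 fact0 invr1 mul1r expr0 addr0.
  by rewrite coef_exp_lt // mulr0 scale0r.
apply: (@scalerI _ _ n.+1%:R); first by rewrite pnatr_eq0.
rewrite binpolyS mulrBl -[in n%:R * _](IH D) //; try lia.
case: D leD => [//|D] leD; rewrite -(IH D); try lia.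
apply/eqP; rewrite eq_sym subr_eq eq_sym; apply/eqP.
rewrite /expc !big_distrr /= scaler_sumr.
rewrite -big_split big_ord_recl [X in X + _ = _](_ : _ = 0) ?add0r; last first.
  rewrite !expr0 !coef1 /= mulr0 scale0r scaler0 add0r.
  by case: n {IH leN leD} => [|n]; rewrite ?mul0r //= mulr0 scale0r mulr0.
apply: eq_bigr => k _; rewrite lift0 /=.
rewrite -polyC_natr mul_polyC !scalerA -scalerDl.
rewrite -scalerAl -scalerAr -exprS scalerA; congr (_ *: _).
have := coef_pow_rec k leN; rewrite factS natrM.
have k1 : k.+1%:R != 0 :> K by rewrite pnatr_eq0.
move: k1; move: (k.+1%:R : K) (k`!%:R : K) => u v u0 E.
transitivity ((u * v)^-1 * (n.+1%:R * (L ^+ k.+1)`_n.+1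
    + n%:R * (L ^+ k.+1)`_n)); first by ring.
by rewrite E invfM -[RHS]mul1r -(mulVf u0); ring.
Qed.
End Exp.

(** The series log (1 + Z) truncated after Z^N; the term k = 0 is zero, since
0^-1 = 0. *)
Definition logpoly (K : fieldType) N (Z : {poly K}) : {poly K} :=
  \sum_(k < N.+1) ((-1) ^+ k.+1 / k%:R) *: Z ^+ k.

Lemma logpoly0 (K : fieldType) N (Z : {poly K}) :
  Z`_0 = 0 -> (logpoly N Z)`_0 = 0.
Proof.
move=> Z0; rewrite coef_sum big1 // => -[[|k] /= _] _; rewrite coefZ.
  by rewrite invr0 mulr0 mul0r.
by rewrite coef_exp_lt ?mulr0.
Qed.

(** Differentiating log (1 + Z) termwise yields a truncated geometric series;
the error term, a multiple of Z^N, vanishes modulo x^N if Z has no constant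
term. *)
Lemma deriv_logpoly (K : numFieldType) N (Z : {poly K}) :
  (1 + Z) * (logpoly N Z)^`() = Z^`() * (1 - (- Z) ^+ N).
Proof.
have -> : (logpoly N Z)^`() = Z^`() * \sum_(k < N) (- Z) ^+ k.
  rewrite /logpoly raddf_sum /= big_ord_recl derivZ expr0.
  rewrite -polyC1 derivC scaler0 add0r mulr_sumr; apply: eq_bigr => k _.
  rewrite lift0 derivZ deriv_exp /= -scaler_nat !scalerA.
  rewrite divfK ?pnatr_eq0 // [(- Z) ^+ k]exprNn !exprS -mul_polyC.
  by rewrite !rmorphM /= rmorphXn /= rmorphN1; ring.
rewrite mulrCA; congr (_ * _).
by rewrite -[RHS]opprK opprB subrX1 -mulNr opprB opprK.
Qed.

Lemma size_le_deg_Sym (J : Sym_basis) : (size J <= deg J)%N.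
Proof. exact: size_le_deg. Qed.

Section LogExp.
Variable K : numFieldType.

Lemma slog_size (x : series Sym_basis K) (Z : {poly K}) N (J : Sym_basis) :
  Z`_0 = 0 ->
  (forall J : composition, (size J <= N)%N ->
     x J - sone (J : Sym_basis) = Z`_(size J)) ->
  (size J <= N)%N -> slog x J = (logpoly N Z)`_(size J).
Proof.
move=> Z0 xZ leJ; rewrite /slog /ssum /logpoly coef_sum.
have E k : (-1) ^+ k.+1 / k%:R * spow (ssub x sone) k J
         = ((-1) ^+ k.+1 / k%:R *: Z ^+ k)`_(size J).
  by rewrite coefZ (spow_size xZ).
under eq_bigr do rewrite E.
have v k : (size J < k)%N -> ((-1) ^+ k.+1 / k%:R *: Z ^+ k)`_(size J) = 0.
  by move=> lt; rewrite coefZ coef_exp_lt ?mulr0.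
rewrite (@sum_ord_vanish _ _ (deg J).+1 _ v) ?ltnS ?size_le_deg_Sym //.
by rewrite (@sum_ord_vanish _ _ N.+1 _ v).
Qed.

(** [spowX] takes powers over polynomials; here they are taken over [K]. *)
Lemma spowX_E (B : gbasis) (x : series B K) (t : B) :
  spowX x t = \sum_(k < (deg t).+1) (k`!%:R^-1 * spow (slog x) k t) *: 'X^k.
Proof.
rewrite /spowX /sexp /ssum; apply: eq_bigr => k _.
rewrite -scalerA; congr (_ *: _).
suff E j u : spow (fun t => slog x t *: 'X) j u = spow (slog x) j u *: 'X^j.
  exact: E.
elim: j u => [|j IH] u /=.
  by rewrite /sone expr0 -mul_polyC mulr1 polyC_natr.
rewrite /smul scaler_suml; apply: eq_bigr => p _.
by rewrite -/(spow _ j) IH -scalerAl -scalerAr scalerA exprS.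
Qed.

(** If the power series attached to log [x] is c log (1 + x), then the one
attached to the power alpha of [x] is (1 + x)^(c alpha). *)
Lemma spowX_size (x : series Sym_basis K) (L : {poly K}) c N (J : Sym_basis) :
  L`_0 = 0 ->
  (forall n, (n < N)%N -> ((1 + 'X) * L^`())`_n = (c%:P)`_n) ->
  (forall J : composition, (size J <= N)%N -> slog x J = L`_(size J)) ->
  (size J <= N)%N -> spowX x J = binpoly (c *: 'X) (size J).
Proof.
move=> L0 dL xL leJ.
rewrite -(exp_binpoly L0 dL leJ (size_le_deg_Sym J)) spowX_E.
by apply: eq_bigr => k _; rewrite (spow_size xL).
Qed.

Lemma coef_expNX N n : ((- 'X : {poly K}) ^+ N)`_n = (-1) ^+ N * (n == N)%:R.
Proof.
have -> : - 'X = (-1)%:P * 'X :> {poly K} by rewrite polyCN polyC1 mulN1r.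
by rewrite exprMn -polyC_exp coefCM coefXn.
Qed.

Lemma sigma1_size (J : composition) : sigma1 K J = (size J <= 1)%:R.
Proof.
rewrite /sigma1 /ssum /S_Sym; case: J => [|[[//|i] pi] [|j J]].
- by rewrite big_ord1.
- rewrite /= /comp_deg /= addn0 big_ord_recr /= eqxx big1 ?add0r // => j _.
  case: (nat_of_ord j) (ltn_ord j) => [//|n lt].
  by rewrite eqseq_cons andbT gtn_eqF.
- by rewrite big1 // => -[[|n] ltn] _; rewrite //= eqseq_cons andbF.
Qed.

Lemma spowX_sigma1 (J : composition) :
  spowX (sigma1 K) J = binpoly 'X (size J).
Proof.
pose N := size J; have X0 : ('X : {poly K})`_0 = 0 by rewrite coefX.
rewrite -['X]scale1r.
apply: (spowX_size (L := logpoly N 'X) (N := N)) => // [|n ltn|I leI].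
- exact: logpoly0.
- rewrite deriv_logpoly derivX mul1r coefB coef_expNX.
  by rewrite ltn_eqF // mulr0 subr0.
- apply: slog_size => // I' leI'.
  rewrite sigma1_size coefX /sone /= comp_deg_eq0.
  by case: (size I') => [|[|n]]; rewrite ?subrr ?subr0.
Qed.

(** This is the expansion of 1 / (1 + x). *)
Lemma sinv_sigma1 (J : composition) : sinv (sigma1 K) J = (-1) ^+ size J.
Proof.
rewrite /sinv /ssum.
have E k : spow (ssub sone (sigma1 K)) k J = (-1) ^+ k * (k == size J)%:R.
  rewrite (@spow_size _ _ (- 'X) (size J)) //.
    by rewrite coef_expNX eq_sym.
  move=> I _; rewrite /ssub sigma1_size coefN coefX /sone /= comp_deg_eq0.
  by case: (size I) => [|[|n]]; rewrite /= ?subrr ?sub0r ?oppr0.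
under eq_bigr do rewrite E.
have lt : (size J < (deg (J : Sym_basis)).+1)%N by exact: size_le_deg.
rewrite (bigD1 (Ordinal lt)) //= eqxx mulr1 big1 ?addr0 // => k.
by rewrite -val_eqE /= => /negPf->; rewrite mulr0.
Qed.

Lemma lambda1E (J : Sym_basis) :
  lambda1 K J = (-1) ^+ deg J * sinv (sigma1 K) J.
Proof.
rewrite /lambda1 /ssum /Lambda /homog big_ord_recr /= eqxx big1 ?add0r // => k _.
by rewrite gtn_eqF // mulr0.
Qed.

Lemma slog_lambda1 (J : Sym_basis) :
  slog (lambda1 K) J = (-1) ^+ deg J * slog (sinv (sigma1 K)) J.
Proof.
rewrite /slog /ssum mulr_sumr; apply: eq_bigr => k _.
rewrite [RHS]mulrCA -spow_sign; congr (_ * _); apply: eq_spow => I.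
rewrite /ssub mulrBr lambda1E; congr (_ - _).
by rewrite /sone; case: (deg I) => [|n]; rewrite ?mulr0 // mulr1.
Qed.

Lemma spowX_sinv_sigma1 (J : composition) :
  spowX (sinv (sigma1 K)) J = binpoly (- 'X) (size J).
Proof.
pose N := size J; pose G : {poly K} := \sum_(i < N.+1) (- 'X) ^+ i.
have coefG n : (n <= N)%N -> G`_n = (-1) ^+ n.
  move=> len; rewrite /G coef_sum.
  under eq_bigr do rewrite coef_expNX.
  rewrite (bigD1 (Ordinal (len : (n < N.+1)%N))) //= eqxx mulr1.
  rewrite big1 ?addr0 // => k.
  by rewrite -val_eqE /= eq_sym => /negPf->; rewrite mulr0.
have GE : (1 + 'X) * G = 1 - (- 'X) ^+ N.+1.
  by rewrite -[RHS]opprK opprB subrX1 -mulNr opprB opprK.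
pose Z := G - 1.
have Z0 : Z`_0 = 0 by rewrite coefB coef1 coefG // subrr.
rewrite -['X]scale1r -scaleNr.
apply: (spowX_size (L := logpoly N Z) (N := N)) => // [|n ltn|I leI].
- exact: logpoly0.
- have [W ZW] := coef0_factorX Z0.
  set A := (1 + 'X) * _.
  have EA : A * (1 - (- 'X) ^+ N.+1)
      = (1 + 'X) * ((1 + 'X) * Z^`()) * (1 - (- Z) ^+ N).
    rewrite -GE -[G](subrK 1) -/Z [Z + 1]addrC /A.
    have := deriv_logpoly N Z; move: (logpoly N Z)^`() Z^`() => d z E.
    transitivity ((1 + 'X) * (1 + 'X) * ((1 + Z) * d)); first by ring.
    by rewrite E; ring.
  have dZ : (1 + 'X) * Z^`() = N.+1%:R * (- 'X) ^+ N - G.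
    have d1 : (1 : {poly K})^`() = 0 by rewrite -[1]polyC1 derivC.
    have -> : Z^`() = G^`() by rewrite /Z derivB d1 subr0.
    have := congr1 (@deriv K) GE.
    rewrite derivM !derivD derivX d1 !add0r mul1r.
    rewrite derivN deriv_exp derivN derivX /= -mulr_natl.
    by move/(canRL (addKr _)) ->; ring.
  pose s : {poly K} := (-1) ^+ N.
  (* (1 + x) (1 + Z) = 1 modulo x^(N+1) gives (1 + x) Z' = - (1 + Z) modulo x^N,
     hence (1 + x) L' = (1 + x)^2 Z' = -1 modulo x^N. *)
  have [R ->] : exists R, A = (-1)%:P + 'X^N * R.
    move: EA; rewrite {}dZ (mulrBr (1 + 'X)) GE ZW exprSr.
    rewrite [(- 'X) ^+ N]exprNn [(- (W * 'X)) ^+ N]exprNn -/s exprMn.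
    move: A => A; move: (W ^+ N) ('X^N) (N.+1%:R) => w y a EA.
    pose u := (1 + 'X) * a * s - s * 'X.
    exists (- A * s * 'X + u + s * w - u * s * w * y).
    rewrite -[A in LHS](addrK (A * (s * y * 'X))) rmorphN1.
    transitivity (A * (1 - s * y * - 'X) - A * (s * y * 'X)); first by ring.
    by rewrite EA /u; ring.
  by rewrite coefD coefXnM ltn addr0.
- apply: slog_size => // I' leI'.
  rewrite sinv_sigma1 coefB coefG // coef1 /sone /= comp_deg_eq0 //.
Qed.

Lemma spowX_lambda1 (J : composition) :
  spowX (lambda1 K) J = (-1) ^+ comp_deg J *: binpoly (- 'X) (size J).
Proof.
rewrite -spowX_sinv_sigma1 !spowX_E scaler_sumr; apply: eq_bigr => k _.
by rewrite scalerA (eq_spow _ slog_lambda1) spow_sign mulrCA.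
Qed.

End LogExp.

(** * Order-preserving maps and the coproduct of forests *)

(** In the terms of the theory of P-partitions, postorder is a natural
labelling. *)
Lemma fdesc_lt F i j : fdesc F i j -> (i < j < fsize F)%N.
Proof.
elim: F i j => //= c IHc r IHr i j; case: ltnP => [lt /IHc|le].
  lia.
by case: eqP => [-> ?|ne /andP[lt /IHr]]; lia.
Qed.

Definition order_pres F (f : nat -> nat) : bool :=
  [forall i : 'I_(fsize F), forall j : 'I_(fsize F),
     fdesc F i j ==> (f i <= f j)%N].

Lemma order_presP F (f : nat -> nat) :
  reflect (forall i j, fdesc F i j -> (f i <= f j)%N) (order_pres F f).
Proof.
apply: (iffP forallP) => [H i j ij|H i].
  have := fdesc_lt ij => /andP[lt lj].
  have /forallP/(_ (Ordinal lj))/implyP := H (Ordinal (ltn_trans lt lj)).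
  exact.
by apply/forallP => j; apply/implyP/H.
Qed.

Lemma eq_order_pres F (f g : nat -> nat) :
  (forall i, (i < fsize F)%N -> f i = g i) -> order_pres F f = order_pres F g.
Proof.
by move=> E; apply: eq_forallb => i; apply: eq_forallb => j; rewrite !E.
Qed.

Lemma order_pres_graft c r (f : nat -> nat) :
  order_pres (Graft c r) f =
    [&& order_pres c f, [forall i : 'I_(fsize c), f i <= f (fsize c)]%N
      & order_pres r (fun i => f ((fsize c).+1 + i)%N)].
Proof.
set m := fsize c; apply/order_presP/and3P.
  move=> H; split.
  - apply/order_presP => i j ij; apply: H => /=; rewrite -/m ifT //.
    by have := fdesc_lt ij; lia.
  - apply/forallP => i; apply: H => /=.
    by rewrite -/m ltnn eqxx.
  - apply/order_presP => i j ij; apply: H => /=; rewrite -/m.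
    have -> : (m.+1 + j < m)%N = false by lia.
    have -> : (m.+1 + j == m)%N = false by lia.
    by rewrite !addKn ij andbT; lia.
move=> [/order_presP Hc /forallP Hm /order_presP Hr] i j /=; rewrite -/m.
case: ltnP => [lt /Hc //|le]; case: eqP => [-> lt|ne /andP[lt /Hr]].
  exact: (Hm (Ordinal lt)).
have lt' : (m < j)%N by lia.
by rewrite !subnKC.
Qed.

Lemma eq_frestr F (P Q : pred nat) :
  (forall i, (i < fsize F)%N -> P i = Q i) -> frestr F P = frestr F Q.
Proof.
elim: F P Q => //= c IHc r IHr P Q E.
rewrite E; last lia.
rewrite (IHc P Q); last by move=> i lt; apply: E; lia.
rewrite (IHr _ (fun i => Q ((fsize c).+1 + i)%N)) // => i lt.
by apply: E; lia.
Qed.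

Lemma frestr_all F (P : pred nat) :
  (forall i, (i < fsize F)%N -> P i) -> frestr F P = F.
Proof.
elim: F P => //= c IHc r IHr P H.
rewrite H; last lia.
rewrite IHc; last by move=> i lt; apply: H; lia.
by rewrite IHr // => i lt; apply: H; lia.
Qed.

Lemma frestr_none F (P : pred nat) :
  (forall i, (i < fsize F)%N -> ~~ P i) -> frestr F P = Empty.
Proof.
elim: F P => //= c IHc r IHr P H.
rewrite (negPf (H _ _)); last lia.
rewrite IHc; last by move=> i lt; apply: H; lia.
by rewrite IHr // => i lt; apply: H; lia.
Qed.

Lemma big_tuple0 (A : nmodType) (T : finType) (h : seq T -> A) :
  \sum_(u : 0.-tuple T) h u = h [::].
Proof.
rewrite (bigD1 [tuple]) //= big1 ?addr0 // => u /negP[].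
by apply/eqP; apply: tuple0.
Qed.

Lemma big_tuple_cons (A : nmodType) (T : finType) n (h : seq T -> A) :
  \sum_(u : n.+1.-tuple T) h u = \sum_x \sum_(u : n.-tuple T) h (x :: u).
Proof.
rewrite pair_big /=.
rewrite (reindex (fun p : T * n.-tuple T => [tuple of p.1 :: p.2])) //=.
exists (fun u => (thead u, [tuple of behead u])) => [[x u] _|u _] /=.
  by rewrite theadE; congr pair; apply: val_inj.
by rewrite [RHS]tuple_eta; apply: val_inj.
Qed.

Lemma big_tuple_cat_cons (A : nmodType) (T : finType) a b (h : seq T -> A) :
  \sum_(u : (a + b).+1.-tuple T) h u =
  \sum_(x : a.-tuple T) \sum_t \sum_(y : b.-tuple T) h (x ++ t :: y).
Proof.
elim: a h => [|a IH] h.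
  rewrite (big_tuple0 (fun x => \sum_t \sum_(y : b.-tuple T) h (x ++ t :: y))).
  exact: big_tuple_cons.
rewrite (big_tuple_cons _ h) (big_tuple_cons _
  (fun x => \sum_t \sum_(y : b.-tuple T) h (x ++ t :: y))).
by apply: eq_bigr => z _; rewrite (IH (fun u => h (z :: u))).
Qed.

Lemma big_cop (A : nmodType) F (h : forest * forest -> A) :
  \sum_(p <- forest_cop F) h p =
  \sum_(u : (fsize F).-tuple bool)
    (if order_pres F (fun i => nth false u i) then
       h (frestr F (fun i => ~~ nth false u i), frestr F (fun i => nth false u i))
     else 0).
Proof.
rewrite /forest_cop big_image big_mkcond /=; apply: eq_bigr => u _.
congr (if _ then _ else _); apply: eq_forallb => i; apply: eq_forallb => j.
by rewrite !(tnth_nth false).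
Qed.

Lemma order_pres_word c r (x y : seq nat) t : size x = fsize c ->
  order_pres (Graft c r) (nth 0%N (x ++ t :: y)) =
    [&& order_pres c (nth 0%N x), all (fun a => a <= t)%N x
      & order_pres r (nth 0%N y)].
Proof.
move=> sx; rewrite order_pres_graft; congr [&& _, _ & _].
- by apply: eq_order_pres => i lt; rewrite nth_cat sx lt.
- rewrite nth_cat sx ltnn subnn /=.
  apply/forallP/(all_nthP 0%N) => [H i lt|H i].
    rewrite sx in lt; have := H (Ordinal lt).
    by rewrite nth_cat sx /= lt.
  by rewrite nth_cat sx ltn_ord H ?sx.
- apply: eq_order_pres => i _; rewrite nth_cat sx ltnNge.
  by rewrite addSn leqW ?leq_addr //= subSn ?leq_addr // addKn.
Qed.

Lemma nth_bool_nat (u : seq bool) i :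
  nat_of_bool (nth false u i) = nth 0%N [seq nat_of_bool b | b <- u] i.
Proof.
case: (ltnP i (size u)) => [lt|le]; first by rewrite (nth_map false).
by rewrite !nth_default ?size_map.
Qed.

(** Since the coproduct is multiplicative, it is determined by its value on a
tree: a cut of the tree with forest of subtrees c either puts its root in the
first factor, and then all of c as well (first sum), or puts it in the second
factor and cuts c arbitrarily (second sum). *)
Lemma big_cop_graft (A : nmodType) (h : forest * forest -> A) c r :
  \sum_(p <- forest_cop (Graft c r)) h p =
    \sum_(q <- forest_cop r) h (Graft c q.1, q.2) +
    \sum_(p <- forest_cop c) \sum_(q <- forest_cop r)
      h (fcat p.1 q.1, Graft p.2 q.2).
Proof.
rewrite !big_cop /=.
pose g (F : forest) (u : seq bool) :=
  (frestr F (fun i => ~~ nth false u i), frestr F (fun i => nth false u i)).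
pose ok F (u : seq bool) := order_pres F (fun i => nth false u i).
rewrite (big_tuple_cat_cons _ _ (fun u => if ok (Graft c r) u
   then h (g (Graft c r) u) else 0)).
have okE (x : (fsize c).-tuple bool) t (y : (fsize r).-tuple bool) :
    ok (Graft c r) (x ++ t :: y) = [&& ok c x, t || ~~ has id x & ok r y].
  rewrite /ok.
  pose n (u : seq bool) := [seq nat_of_bool b | b <- u].
  have E F (u : seq bool) : order_pres F (fun i => nth false u i)
       = order_pres F (nth 0%N (n u)).
    by apply: eq_order_pres => i _; rewrite nth_bool_nat.
  rewrite !E {1}/n map_cat /= order_pres_word ?size_map ?size_tuple //.
  congr [&& _, _ & _]; rewrite all_map; case: t => /=.
    by apply/allP => -[].
  by rewrite -all_predC; apply: eq_all => -[].
have gE (x : (fsize c).-tuple bool) t (y : (fsize r).-tuple bool) :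
    g (Graft c r) (x ++ t :: y) =
    if t then (fcat (g c x).1 (g r y).1, Graft (g c x).2 (g r y).2)
    else (Graft (g c x).1 (g r y).1, fcat (g c x).2 (g r y).2).
  have nx i : (i < fsize c)%N -> nth false (x ++ t :: y) i = nth false x i.
    by move=> lt; rewrite nth_cat size_tuple lt.
  have ny i : nth false (x ++ t :: y) ((fsize c).+1 + i) = nth false y i.
    rewrite nth_cat size_tuple ltnNge addSn leqW ?leq_addr //=.
    by rewrite subSn ?leq_addr // addKn.
  rewrite /g /= [nth false (x ++ t :: y) (fsize c)]nth_cat size_tuple ltnn subnn /=.
  rewrite (eq_frestr (F := c) (Q := fun i => ~~ nth false x i)); last first.
    by move=> i /nx ->.
  rewrite (eq_frestr (F := c) (P := fun i => nth _ (_ ++ _) _)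
     (Q := fun i => nth false x i)); last by move=> i /nx ->.
  rewrite (eq_frestr (F := r) (Q := fun i => ~~ nth false y i)); last first.
    by move=> i _; rewrite ny.
  rewrite (eq_frestr (F := r) (P := fun i => nth _ (_ ++ _) _)
     (Q := fun i => nth false y i)); last by move=> i _; rewrite ny.
  by case: t {nx ny}.
transitivity (
  \sum_(x : (fsize c).-tuple bool)
   (\sum_(y : (fsize r).-tuple bool)
     (if (x == nseq (fsize c) false :> seq bool) && ok r y then
        h (Graft c (g r y).1, (g r y).2) else 0) +
    \sum_(y : (fsize r).-tuple bool)
     (if ok c x && ok r y then
        h (fcat (g c x).1 (g r y).1, Graft (g c x).2 (g r y).2) else 0))).
  apply: eq_bigr => x _; rewrite -big_split exchange_big.
  apply: eq_bigr => y _.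
  rewrite big_bool /= !okE !gE /= addrC; congr (_ + _).
  have -> : ~~ has id x = (x == nseq (fsize c) false :> seq bool).
    rewrite -all_predC -[X in nseq X](size_tuple x).
    by apply/idP/eqP => [H|->]; [apply/all_pred1P; apply: sub_all H => -[]
      |rewrite all_nseq orbT].
  case: eqP => [xE|_] /=; last by rewrite andbF.
  have okx : ok c x.
    by apply/order_presP => i j _; rewrite xE !nth_nseq; do 2 case: ifP.
  have f0 : frestr c (fun i => nth false x i) = Empty.
    by apply: frestr_none => i _; rewrite xE nth_nseq; case: ifP.
  have f1 : frestr c (fun i => ~~ nth false x i) = c.
    by apply: frestr_all => i _; rewrite xE nth_nseq; case: ifP.
  by rewrite okx /= f0 f1.
rewrite big_split /=; congr (_ + _).
  rewrite (bigD1 [tuple of nseq (fsize c) false]) //= eqxx.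
  rewrite [X in _ + X]big1 ?addr0 // => x /negPf.
  by rewrite -val_eqE /= => ->; rewrite big1.
apply: eq_bigr => x _; rewrite /ok; case: (order_pres c _) => /=.
  by rewrite big_cop.
exact: big1.
Qed.

Definition count_pres F m : nat :=
  \sum_(w : (fsize F).-tuple 'I_m) order_pres F (nth 0%N (map val w)).

Lemma big_tuple_narrow (A : nmodType) m j n (h : seq nat -> A) : (j <= m)%N ->
  \sum_(w : n.-tuple 'I_m)
    (if all (fun a => a < j)%N (map val w) then h (map val w) else 0) =
  \sum_(w : n.-tuple 'I_j) h (map val w).
Proof.
move=> le_jm; elim: n h => [|n IH] h.
  rewrite (big_tuple0 (fun w : seq 'I_m => if all (fun a => a < j)%N (map val w)
    then h (map val w) else 0)) /=.
  by rewrite (big_tuple0 (fun w : seq 'I_j => h (map val w))).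
rewrite (big_tuple_cons _ (fun w : seq 'I_m => if all (fun a => a < j)%N (map val w)
    then h (map val w) else 0)) /=.
rewrite (big_tuple_cons _ (fun w : seq 'I_j => h (map val w))) /=.
rewrite (big_ord_widen m (fun x => \sum_(u : n.-tuple 'I_j) h (x :: map val u))) //.
rewrite [RHS]big_mkcond /=; apply: eq_bigr => x _.
by case: ltnP => _ /=; [exact: (IH (fun u => h (val x :: u))) | exact: big1].
Qed.

(** A map on a tree is given by the value j of the root and a map with values
at most j on its subtrees. *)
Lemma count_pres_graft c r m :
  count_pres (Graft c r) m =
    ((\sum_(j < m) count_pres c j.+1) * count_pres r m)%N.
Proof.
rewrite /count_pres /=.
rewrite (big_tuple_cat_cons _ _ (fun w : seq 'I_m =>
  nat_of_bool (order_pres (Graft c r) (nth 0%N (map val w))))).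
rewrite exchange_big big_distrl /=; apply: eq_bigr => t _.
rewrite -(@big_tuple_narrow nat m t.+1 (fsize c)
  (fun w => nat_of_bool (order_pres c (nth 0%N w)))) //.
rewrite big_distrl /=; apply: eq_bigr => x _.
rewrite big_distrr /=; apply: eq_bigr => y _.
rewrite map_cat /= order_pres_word ?size_map ?size_tuple //.
rewrite (eq_all (a2 := fun a => a <= t)%N) //.
by case: (all _ _); rewrite ?andbF //= mulnb.
Qed.

(** * Powers of the sum of all the X_F *)

Section NCKPow.
Variable A : comNzRingType.
Notation ones := ((fun => 1) : series NCK_basis A).

Definition pow_ones m F : A := spow ones m F.

Arguments pow_ones : simpl never.
Arguments spow : simpl never.

Lemma pow_onesS m F : pow_ones m.+1 F = \sum_(p <- forest_cop F) pow_ones m p.2.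
Proof. by apply: eq_bigr => p _; rewrite mul1r. Qed.

Lemma pow_ones_Empty m : pow_ones m Empty = 1.
Proof.
elim: m => [//|m IH]; rewrite pow_onesS big_cop.
rewrite (big_tuple0 (fun u => if order_pres Empty (fun i => nth false u i)
  then pow_ones m (frestr Empty (fun i => nth false u i)) else 0)) /=.
by rewrite ifT //; apply/order_presP.
Qed.

Lemma pow_ones1 F : pow_ones 1 F = 1.
Proof.
elim: F => [|c _ r IH]; first exact: pow_ones_Empty.
rewrite pow_onesS (@big_cop_graft _ (fun p => pow_ones 0 p.2)) /= -pow_onesS IH.
by rewrite big1 ?addr0 // => p _; rewrite big1.
Qed.

(** Same recursion as [count_pres_graft]: after cutting off the first of m + 1
levels, either the whole tree was in it (the term j = 0) or the root remains
and the induction hypothesis applies to what is left above the cut. *)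
Lemma pow_ones_graft m c r :
  pow_ones m (Graft c r) = (\sum_(j < m) pow_ones j.+1 c) * pow_ones m r.
Proof.
elim: m c r => [|m IH] c r; first by rewrite big_ord0 mul0r.
rewrite pow_onesS (@big_cop_graft _ (fun p => pow_ones m p.2)) /=.
under [X in _ + X]eq_bigr => p _ do
  (under eq_bigr do rewrite IH; rewrite -mulr_sumr -pow_onesS).
rewrite -pow_onesS -mulr_suml exchange_big /= -[X in X + _]mul1r -mulrDl.
congr (_ * _); rewrite [RHS]big_ord_recl.
rewrite pow_ones1; congr (_ + _); apply: eq_bigr => j _.
by rewrite lift0 [RHS]pow_onesS.
Qed.

Lemma pow_ones_count m F : pow_ones m F = (count_pres F m)%:R.
Proof.
elim: F m => [|c IHc r IHr] m.
  rewrite pow_ones_Empty /count_pres.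
  rewrite (big_tuple0 (fun w : seq 'I_m =>
    nat_of_bool (order_pres Empty (nth 0%N (map val w))))).
  by rewrite (introT (order_presP _ _)).
rewrite pow_ones_graft count_pres_graft natrM IHr; congr (_ * _); rewrite natr_sum.
by apply: eq_bigr => j _; rewrite IHc.
Qed.

Notation T := ((fun F => (fsize F != 0%N)%:R) : series NCK_basis A).

Lemma smul_sone_l (x : series NCK_basis A) F : smul sone x F = x F.
Proof.
elim: F x => [|c IHc r IHr] x.
  rewrite /smul big_cop /sone.
  rewrite (big_tuple0 (fun u => if order_pres Empty (fun i => nth false u i)
    then sone (frestr Empty (fun i => ~~ nth false u i) : NCK_basis) *
      x (frestr Empty (fun i => nth false u i)) else 0)).
  by rewrite (introT (order_presP _ _)) //= /sone /= mul1r.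
rewrite /smul (@big_cop_graft _ (fun p => sone (p.1 : NCK_basis) * x p.2)) /=.
rewrite big1 ?add0r => [|q _]; last by rewrite /sone mul0r.
rewrite -[RHS](IHc (fun C => x (Graft C r))); apply: eq_bigr => p _.
rewrite -(IHr (fun G => x (Graft p.2 G))) /smul mulr_sumr.
apply: eq_bigr => q _; rewrite mulrA; congr (_ * _).
by rewrite /sone /= fsize_cat addn_eq0 -mulnb natrM.
Qed.

(** Pascal's rule, since [ones] = 1 + T. The bound [N] exceeds the degree, so
that the higher powers of T vanish; it is left free because the induction needs
the same bound on forests of smaller degree. *)
Lemma pow_ones_binomial m N F : (fsize F < N)%N ->
  pow_ones m F = \sum_(k < N) 'C(m, k)%:R * spow T k F.
Proof.
elim: m N F => [|m IH] [//|N] F ltN.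
  rewrite big_ord_recl big1 ?addr0 => [|k _]; last by rewrite bin0n mul0r.
  by rewrite bin0 mul1r.
have -> : pow_ones m.+1 F = pow_ones m F + smul T (pow_ones m) F.
  rewrite -[X in X + _]smul_sone_l /smul -big_split; apply: eq_bigr => p _ /=.
  rewrite -/(pow_ones m _) -mulrDl /sone /=.
  by congr (_ * _); case: eqP => _; rewrite ?addr0 ?add0r.
have -> : smul T (pow_ones m) F = \sum_(k < N) 'C(m, k)%:R * spow T k.+1 F.
  transitivity (\sum_(k < N.+1) 'C(m, k)%:R * spow T k.+1 F).
    under [RHS]eq_bigr do rewrite mulr_sumr.
    rewrite exchange_big; apply: big_cop_deg => p dp.
    rewrite (IH N.+1) ?mulr_sumr; last by move: dp => /=; lia.
    by apply: eq_bigr => k _; rewrite mulrCA.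
  rewrite big_ord_recr /= spow_vanish ?mulr0 ?addr0 //.
  by move=> t /= ->.
rewrite (IH N.+1) // !big_ord_recl !bin0 -addrA; congr (_ + _).
rewrite -big_split; apply: eq_bigr => k _.
by rewrite lift0 binS natrD mulrDl.
Qed.

Lemma pow_ones_comps m F :
  pow_ones m F = \sum_(J <- comps (fsize F))
    'C(m, size J)%:R * sprod [seq S_NCK A (val i) | i <- J] F.
Proof.
have T0 (u : NCK_basis) : deg u = 0%N -> T u = 0 by move=> /= ->.
rewrite (@pow_ones_binomial m (fsize F).+1) //.
have E k : 'C(m, k)%:R * spow T k F = \sum_(J <- comps (fsize F))
   if size J == k then 'C(m, k)%:R * sprod [seq S_NCK A (val i) | i <- J] F
   else 0.
  rewrite (spow_homog _ _ T0) mulr_sumr big_mkcond; apply: eq_bigr => J _.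
  case: ifP => // _; congr (_ * sprod _ F); apply: eq_map => i.
  apply/boolp.funext => G; rewrite /homog /S_NCK /=; case: eqP => // ->.
  by case: i => [[]].
under eq_bigr do rewrite E.
rewrite exchange_big !big_seq; apply: eq_bigr => J.
rewrite mem_comps => /eqP dJ.
have lt : (size J < (fsize F).+1)%N by rewrite ltnS -dJ size_le_deg.
rewrite (bigD1 (Ordinal lt)) //= eqxx big1 ?addr0 // => k.
by rewrite -val_eqE /= eq_sym => /negPf->.
Qed.

End NCKPow.

(** * P-partitions *)

(** Encodes the lexicographic order on the pairs ([tnth w i], [i]). *)
Definition lexkey n m (w : n.-tuple 'I_m) (i : 'I_n) : nat := (tnth w i * n + i)%N.

Definition sorts n m (s : 'S_n) (w : n.-tuple 'I_m) : bool :=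
  sorted ltn [seq lexkey w (s p) | p <- enum 'I_n].

Lemma lexkey_lt n m (w : n.-tuple 'I_m) i j :
  (lexkey w i < lexkey w j)%N =
    (tnth w i < tnth w j)%N || (tnth w i == tnth w j) && (i < j)%N.
Proof.
rewrite /lexkey -val_eqE /=.
have := ltn_ord i; have := ltn_ord j.
move: (nat_of_ord i) (nat_of_ord j) (nat_of_ord (tnth w i)) (nat_of_ord (tnth w j)).
move=> a b x y lb la; case: (ltngtP x y) => [lt|lt|->] /=; try nia.
Qed.

Lemma lexkey_inj n m (w : n.-tuple 'I_m) : injective (lexkey w).
Proof.
move=> i j /(congr1 (modn^~ n)); rewrite /= /lexkey !modnMDl.
by rewrite !modn_small //; apply: val_inj.
Qed.

Lemma sortsP n m (s : 'S_n) (w : n.-tuple 'I_m) : sorts s w ->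
  forall i j, ((s^-1)%g i < (s^-1)%g j)%N = (lexkey w i < lexkey w j)%N.
Proof.
move=> sw i j; set p := (s^-1)%g i; set q := (s^-1)%g j.
have <- : s p = i by rewrite permKV.
have <- : s q = j by rewrite permKV.
have H (a b : 'I_n) : (a < b)%N -> (lexkey w (s a) < lexkey w (s b))%N.
  move=> lt.
  have nthE (c : 'I_n) : nth 0%N [seq lexkey w (s p) | p <- enum 'I_n] c
      = lexkey w (s c).
    by rewrite (nth_map c) ?nth_ord_enum // size_enum_ord.
  rewrite -!nthE; apply: (sorted_ltn_nth ltn_trans) => //;
    by rewrite inE size_map size_enum_ord.
case: (ltngtP p q) => [/H|/H|/val_inj ->]; [by move=> -> | lia | by rewrite ltnn].
Qed.

(** The pairs (w i, i) are distinct, so exactly one permutation sorts them. *)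
Lemma sum_sorts n m (w : n.-tuple 'I_m) : (\sum_(s : 'S_n) sorts s w = 1)%N.
Proof.
have [s0 s0w] : exists s : 'S_n, sorts s w.
  pose e := sort (relpre (lexkey w) leq) (enum 'I_n).
  have se : size e = n by rewrite size_sort size_enum_ord.
  have ue : uniq e by rewrite sort_uniq enum_uniq.
  have /injectiveP inj : injectiveb (fun p : 'I_n => nth p e p).
    apply/injectiveP => p q; rewrite [nth q e q](set_nth_default p) ?se // => /eqP.
    by rewrite nth_uniq ?se // => /eqP/val_inj.
  exists (perm inj); rewrite /sorts.
  have -> : [seq lexkey w (perm inj p) | p <- enum 'I_n] = map (lexkey w) e.
    transitivity (map (lexkey w) [seq nth p e p | p <- enum 'I_n]).
      by rewrite -map_comp; apply: eq_map => p /=; rewrite permE.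
    congr (map _ _); case: (n) e se {ue inj} => [|k] e se.
      by rewrite (size0nil se) enum_ord0.
    apply: (@eq_from_nth _ ord0); rewrite size_map size_enum_ord // => i lt.
    rewrite (nth_map ord0) ?size_enum_ord // nth_enum_ord //.
    by apply: set_nth_default; rewrite se.
  rewrite ltn_sorted_uniq_leq map_inj_uniq ?ue; last exact: lexkey_inj.
  rewrite sorted_map; apply: sort_sorted => i j; exact: leq_total.
rewrite (bigD1 s0) //= s0w big1 // => s ne; apply/eqP; rewrite eqb0.
apply: contra ne => sw; apply/eqP/permP => p.
have E : [seq lexkey w (s p) | p <- enum 'I_n] = [seq lexkey w (s0 p) | p <- enum 'I_n].
  apply: (irr_sorted_eq ltn_trans ltnn sw s0w) => x.
  apply/mapP/mapP => -[q _ ->].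
    by exists ((s0^-1)%g (s q)); rewrite ?mem_enum ?permKV.
  by exists ((s^-1)%g (s0 q)); rewrite ?mem_enum ?permKV.
apply: (@lexkey_inj _ _ w).
by move/eq_in_map: E => /(_ p); rewrite mem_enum => ->.
Qed.

(** Since F is naturally labelled, a relation i <_F j makes w i <= w j
equivalent to (w i, i) being smaller than (w j, j), that is, to i standing
before j in s. *)
Lemma sorts_linext F m s (w : (fsize F).-tuple 'I_m) : sorts s w ->
  order_pres F (nth 0%N (map val w)) = (s \in linext F).
Proof.
move=> sw.
have nthE (i : 'I_(fsize F)) : nth 0%N (map val w) i = tnth w i.
  by rewrite (nth_map (tnth w i)) ?size_tuple // -tnth_nth.
rewrite inE; apply: eq_forallb => i; apply: eq_forallb => j.
case: (boolP (fdesc F i j)) => //= ij; rewrite !nthE (sortsP sw) lexkey_lt.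
have /andP[-> _] := fdesc_lt ij.
by rewrite andbT leq_eqVlt orbC.
Qed.

Definition ascents i s := count id (pairmap ltn i s).

Lemma hockey q m a l : (q <= m)%N -> (a <= l)%N ->
  (\sum_(q <= y < m) 'C(m.-1 - y + a, l) = 'C(m - q + a, l.+1))%N.
Proof.
move=> le_qm le_al; rewrite -[X in (\sum_(X <= _ < _) _)%N]add0n big_addn.
rewrite big_nat_rev /= add0n.
transitivity (\sum_(0 <= y < m - q) 'C(y + a, l))%N.
  by apply: eq_big_nat => y lt; congr 'C(_, _); lia.
elim: (m - q)%N => [|k IH]; first by rewrite big_geq // bin_small.
by rewrite big_nat_recr //= IH addSn binS.
Qed.

(** The keys of [lexkey] for labels [s] that carry the values [a]. *)
Definition zipkey n (s a : seq nat) := [seq (p.2 * n + p.1)%N | p <- zip s a].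

(** The values must increase weakly along [s], and strictly at its descents;
summing over the first one is the hockey-stick identity. *)
Lemma count_path n m i x (s : seq nat) :
  (i < n)%N -> all (fun j => j < n)%N s -> (x < m)%N ->
  (\sum_(a : (size s).-tuple 'I_m) path ltn (x * n + i) (zipkey n s (map val a))
   = 'C(m.-1 - x + ascents i s, size s))%N.
Proof.
elim: s i x => [|j s IH] i x lti; first by
  rewrite (big_tuple0 (fun a : seq 'I_m =>
    nat_of_bool (path ltn (x * n + i) (zipkey n [::] (map val a))))) bin0.
move=> /andP[ltj lts] ltx.
rewrite (big_tuple_cons _ (fun a : seq 'I_m =>
    nat_of_bool (path ltn (x * n + i) (zipkey n (j :: s) (map val a))))) /=.
pose b := ~~ (i < j)%N.
transitivity (\sum_(y < m | (x + b <= y)%N) 'C(m.-1 - y + ascents j s, size s))%N.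
  rewrite [RHS]big_mkcond /=; apply: eq_bigr => y _.
  have -> : (x * n + i < y * n + j)%N = (x + b <= y)%N.
    rewrite /b; case: (ltnP i j) => ij /=; rewrite ?addn0 ?addn1; apply/idP/idP; nia.
  by case: leqP => _ /=; [exact: IH | rewrite big1].
rewrite -(big_mkord (fun y => x + b <= y)%N (fun y => 'C(m.-1 - y + ascents j s, size s))).
have bm : (x + b <= m)%N by rewrite /b; case: (i < j)%N; lia.
rewrite (big_cat_nat _ bm) //= big_nat_cond big1 ?add0n; last by move=> y; lia.
rewrite big_nat_cond (eq_bigl (fun y => (x + b <= y < m)%N)); last by move=> y; lia.
rewrite -big_nat hockey //; last first.
  by rewrite /ascents (leq_trans (count_size _ _)) // size_pairmap.
by rewrite /ascents /= /b; congr 'C(_, _); case: (i < j)%N; lia.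
Qed.

Lemma count_sorted n m (s : seq nat) :
  all (fun j => j < n)%N s ->
  (\sum_(a : (size s).-tuple 'I_m) sorted ltn (zipkey n s (map val a))
   = if s is j :: s' then 'C(m + ascents j s', size s) else 1)%N.
Proof.
case: s => [|j s] /=.
  by rewrite (big_tuple0 (fun a : seq 'I_m =>
    nat_of_bool (sorted ltn (zipkey n [::] (map val a))))).
move=> /andP[ltj lts].
rewrite (big_tuple_cons _ (fun a : seq 'I_m =>
    nat_of_bool (sorted ltn (zipkey n (j :: s) (map val a))))) /=.
under eq_bigr do rewrite count_path //.
rewrite -(big_mkord xpredT (fun y => 'C(m.-1 - y + ascents j s, size s))).
rewrite hockey ?subn0 //.
by rewrite /ascents (leq_trans (count_size _ _)) // size_pairmap.
Qed.

Lemma ascents_sum j s :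
  ascents j s = (\sum_(i < size s) (nth 0 (j :: s) i < nth 0 s i))%N.
Proof.
elim: s j => [|k s IH] j; first by rewrite big_ord0.
by rewrite big_ord_recl -/(ascents k s) /ascents /= -/(ascents k s) IH.
Qed.

Lemma ascents_descents n (s : 'S_n.+1) j t :
  [seq val (s p) | p <- enum 'I_n.+1] = j :: t ->
  (ascents j t + #|descents s| = n)%N.
Proof.
move=> E.
have st : size t = n.
  by have := congr1 size E; rewrite size_map size_enum_ord => -[].
have nthE (c : 'I_n.+1) : nth 0%N (j :: t) c = s c.
  by rewrite -E (nth_map c) ?nth_ord_enum // size_enum_ord.
rewrite ascents_sum st -sum1_card [X in (_ + X)%N]big_mkcond big_ord_recr /=.
rewrite [X in (_ + (_ + X))%N](_ : _ = 0%N).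
  rewrite addn0 -big_split /= -[RHS]card_ord -sum1_card; apply: eq_bigr => i _.
  have lt : (i < n.+1)%N by rewrite ltnS ltnW.
  have -> : nth 0%N (j :: t) i = s (Ordinal lt) by rewrite -nthE.
  have -> : nth 0%N t i = s (lift ord0 i) by rewrite -nthE.
  have -> : widen_ord (leqnSn n) i = Ordinal lt by apply: val_inj.
  have -> : (Ordinal lt \in descents s) = (s (lift ord0 i) < s (Ordinal lt))%N.
    rewrite inE; apply/existsP/idP => [[q /andP[/eqP qE]]|lt'].
      by have -> : q = lift ord0 i by apply: val_inj.
    by exists (lift ord0 i); rewrite lift0 eqxx.
  case: ltngtP => // /val_inj/perm_inj/(congr1 val) /=; rewrite /bump; lia.
rewrite ifF //; apply/negP; rewrite inE => /existsP[q /andP[/eqP qE _]].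
by have := ltn_ord q; rewrite qE /= ltnn.
Qed.

Lemma count_sorts n m (s : 'S_n) :
  (\sum_(w : n.-tuple 'I_m) sorts s w = 'C(m + n - #|descents s|.+1, n))%N.
Proof.
pose l := [seq val (s p) | p <- enum 'I_n].
have sl : size l = n by rewrite size_map size_enum_ord.
have all_l : all (fun j => j < n)%N l by apply/allP => _ /mapP[p _ ->]; apply: ltn_ord.
rewrite (reindex
  (fun a : n.-tuple 'I_m => [tuple tnth a ((s^-1)%g i) | i < n])) /=; last first.
  exists (fun w => [tuple tnth w (s i) | i < n]) => w _;
    by apply: eq_from_tnth => i; rewrite !tnth_mktuple ?permK ?permKV.
transitivity (\sum_(a : n.-tuple 'I_m) sorted ltn (zipkey n l (map val a)))%N.
  apply: eq_bigr => a _; congr (nat_of_bool (sorted _ _)).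
  have -> : map val a = [seq val (tnth a p) | p <- enum 'I_n].
    by rewrite -{1}(map_tnth_enum a) -map_comp.
  rewrite /zipkey /l zip_map -map_comp.
  by apply: eq_map => p /=; rewrite /lexkey tnth_mktuple permK.
move: (count_sorted m all_l); rewrite sl => ->.
case: n s @l sl all_l => [|n] s l sl all_l.
  by rewrite (size0nil sl) bin0.
case El: l => [|j t]; first by rewrite El in sl.
congr 'C(_, _); rewrite addnS subSS.
by rewrite -[X in (m + X - _)%N](ascents_descents El) addnA addnK.
Qed.

(** The fundamental theorem of P-partitions for F. It starts at m + 1 because
m + n - r(s) would be negative for the empty forest and m = 0. *)
Lemma Gamma_nat (K : numFieldType) F m :
  (Gamma K F).[m.+1%:R] = (count_pres F m.+1)%:R.
Proof.
have -> : count_pres F m.+1 =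
   (\sum_(s in linext F) 'C(m.+1 + fsize F - #|descents s|.+1, fsize F))%N.
  transitivity (\sum_(w : (fsize F).-tuple 'I_m.+1) \sum_(s : 'S_(fsize F))
     if s \in linext F then sorts s w else false)%N.
    apply: eq_bigr => w _.
    rewrite -[LHS]muln1 -(sum_sorts w) big_distrr /=; apply: eq_bigr => s _.
    case: (boolP (sorts s w)) => [/sorts_linext ->|_]; last by rewrite muln0 if_same.
    by rewrite muln1; case: ifP.
  rewrite exchange_big [RHS]big_mkcond; apply: eq_bigr => s _.
  by case: ifP => _ /=; [exact: count_sorts | rewrite big1].
rewrite /Gamma horner_sum natr_sum; apply: eq_bigr => s _.
rewrite horner_binpoly -binpoly_nat; congr (_.[_]).
rewrite !hornerE -!polyC_natr !hornerC natrB ?natrD //.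
have := max_card (descents s); rewrite card_ord; lia.
Qed.

(** * The coefficient of X_F in the powers of sigma_1 and lambda_1 *)

Section Final.
Variable K : numFieldType.

Lemma poly_eq_nat (p q : {poly K}) :
  (forall m, p.[m.+1%:R] = q.[m.+1%:R]) -> p = q.
Proof.
move=> E; apply/eqP; rewrite -subr_eq0; apply/eqP.
apply: (@roots_geq_poly_eq0 _ _ [seq i.+1%:R | i <- iota 0 (size (p - q))]).
- apply/allP => _ /mapP[i _ ->].
  by rewrite /root hornerD hornerN E subrr.
- rewrite map_inj_uniq ?iota_uniq // => i j /eqP.
  by rewrite eqr_nat eqSS => /eqP.
- by rewrite size_map size_iota.
Qed.

Lemma sprod_S_polyC (I : composition) (F : forest) :
  sprod [seq S_NCK {poly K} (val i) | i <- I] (F : NCK_basis)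
  = (sprod [seq S_NCK K (val i) | i <- I] (F : NCK_basis))%:P.
Proof.
rewrite -sprod_morph -map_comp; congr (sprod _ _); apply: eq_map => i /=.
by apply/boolp.funext => G; rewrite /S_NCK rmorph_nat.
Qed.

(** Both sides take the same values at the positive integers. *)
Lemma embed_spowX_sigma1 F : embed (spowX (sigma1 K)) F = Gamma K F.
Proof.
apply: poly_eq_nat => m; rewrite Gamma_nat -pow_ones_count pow_ones_comps.
rewrite /embed horner_sum.
apply: eq_bigr => J _.
by rewrite spowX_sigma1 sprod_S_polyC hornerM hornerC binpoly_nat.
Qed.

Lemma slog_deg0 (B : gbasis) (x : series B K) (u : B) :
  deg u = 0%N -> slog x u = 0.
Proof. by move=> du; rewrite /slog /ssum du big_ord1 invr0 mulr0 mul0r. Qed.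

Lemma coef_spowX (B : gbasis) (x : series B K) (t : B) k :
  (spowX x t)`_k = k`!%:R^-1 * spow (slog x) k t.
Proof.
rewrite spowX_E coef_sum.
under eq_bigr do rewrite coefZ coefXn.
have [le|lt] := leqP k (deg t).
  rewrite (bigD1 (Ordinal (le : (k < (deg t).+1)%N))) //= eqxx mulr1.
  rewrite big1 ?addr0 // => j.
  by rewrite -val_eqE /= eq_sym => /negPf->; rewrite mulr0.
rewrite spow_vanish //; last exact: slog_deg0.
rewrite mulr0 big1 // => j _.
by rewrite gtn_eqF ?mulr0 // (leq_trans (ltn_ord j)).
Qed.

Lemma phi_prod_eq0 (I J : composition) :
  comp_deg J != comp_deg I -> phi_prod K I J = 0.
Proof. exact: (@sprod_homog_eq0 Sym_basis). Qed.

Lemma spow_slog_sigma1 k (J : composition) :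
  spow (slog (sigma1 K)) k J =
  \sum_(I <- comps (comp_deg J) | size I == k) phi_prod K I J.
Proof. by rewrite (@spow_homog Sym_basis) //; exact: slog_deg0. Qed.

Lemma coef_spowX_sigma1 k (J : composition) :
  (spowX (sigma1 K) J)`_k =
     k`!%:R^-1 *
       ssum (fun n J' => \sum_(I <- comps n | size I == k) phi_prod K I J')
         (J : Sym_basis).
Proof.
rewrite coef_spowX; congr (_ * _).
rewrite /ssum big_ord_recr /= big1 ?add0r ?spow_slog_sigma1 //.
move=> n _; rewrite big_seq_cond big1 // => I /andP[In _].
rewrite mem_comps in In; apply: phi_prod_eq0.
by rewrite (eqP In) gtn_eqF.
Qed.

Lemma eulerian_coef n k (J : composition) : comp_deg J = n ->
  eulerian K n k J = (spowX (sigma1 K) J)`_k.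
Proof.
by move=> dJ; rewrite coef_spowX spow_slog_sigma1 dJ.
Qed.

Lemma embed_eulerian F k :
  embed (eulerian K (fsize F) k) F = (Gamma K F)`_k.
Proof.
rewrite -embed_spowX_sigma1 /embed coef_sum.
rewrite !big_seq; apply: eq_bigr => J; rewrite mem_comps => /eqP dJ.
by rewrite (eulerian_coef _ dJ) sprod_S_polyC coefMC.
Qed.

Lemma Gamma_chi F : Gamma K F = (-1) ^+ fsize F *: (chi K F \Po (- 'X)).
Proof.
rewrite -embed_spowX_sigma1 /chi /embed rmorph_sum scaler_sumr /=.
rewrite !big_seq; apply: eq_bigr => J; rewrite mem_comps => /eqP dJ.
rewrite spowX_sigma1 spowX_lambda1 dJ rmorphM /= sprod_S_polyC comp_polyC.
rewrite comp_polyZ comp_binpoly rmorphN /= comp_polyX opprK.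
by rewrite -[in RHS]scalerAl scalerA -expr2 sqrr_sign scale1r.
Qed.
End Final.

Theorem mainTheorem4 (R : realType) :
  (forall (k : nat) (J : composition),
     (spowX (sigma1 R[i]) J)`_k =
     k`!%:R^-1 *
       ssum (fun n J' => \sum_(I <- comps n | size I == k) phi_prod R[i] I J')
         (J : Sym_basis))
  /\
  (forall (F : forest) (n k : nat), fsize F = n ->
     embed (eulerian R[i] n k) F = (Gamma R[i] F)`_k
     /\
     (Gamma R[i] F)`_k = (-1) ^+ n * (chi R[i] F \Po (- 'X))`_k).
Proof.
split=> [k J|F n k <-]; first exact: coef_spowX_sigma1.
by split; [exact: embed_eulerian | rewrite -coefZ -Gamma_chi].
Qed.
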